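(* Let $G$ be an edge-colored graph of order $n$. If $e(G)+c(G)\geq \frac{n(n+1)}{2}+1$, then $G$ contains a properly colored $C_4$. Moreover, if $e(G)+c(G)=\frac{n(n+1)}{2}$ and $G$ contains no properly colored $C_4$, then $G$ is complete and has a layered structure.
   Context: Graphs are finite and simple. An edge-colored graph is a graph with an arbitrary assignment of a color to each edge (not necessarily proper). $e(G)$ is the number of edges of $G$ and $c(G)$ is the number of colors appearing on the edges of $G$. A subgraph is rainbow if all its edges have distinct colors, and properly colored if any two of its adjacent edges have distinct colors. $C_4$ is the cycle on 4 vertices, as a (not necessarily induced) subgraph. Layered structure: an edge-colored complete graph $K$ on $m$ vertices using exactly $m$ colors has a layered structure if (recursively) one of the following holds: (1) there is a vertex $v$ all of whose incident edges have a single color, and $K-v$ is an edge-colored complete graph on $m-1$ vertices using exactly $m-1$ colors that has a layered structure; (2) there is a rainbow triangle $uvw$ with, say, $uv$ red, $vw$ blue and $uw$ green, such that all other edges incident to $u$ are red, all other edges incident to $v$ are blue, all other edges incident to $w$ are green, and $K-\{u,v,w\}$ is an edge-colored complete graph on $m-3$ vertices using exactly $m-3$ colors that has a layered structure; (3) there is a vertex $v$ whose incident edges all have pairwise distinct colors, while all other edges of $K$ have one single color, distinct from the colors of the edges incident to $v$. *)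

(* Defs.v *)
From mathcomp Require Import all_boot.

Set Implicit Arguments.
Unset Strict Implicit.
Unset Printing Implicit Defensive.

(* Edges are two-element vertex sets, so the edge [xy] is [[set x; y]].  The
   values of [color] outside [edges] are irrelevant: every definition below
   evaluates it on edges only. *)
Record ecgraph (V : finType) (C : eqType) := ECGraph {
  edges : {set {set V}};
  card_edge : forall E, E \in edges -> #|E| = 2;
  color : {set V} -> C
}.

Section EdgeColoredGraphs.
Variables (V : finType) (C : eqType) (G : ecgraph V C).
Implicit Types (E : {set V}) (F : {set {set V}}) (S : {set V}).

Definition colors F : seq C := undup [seq color G E | E in F].

Definition num_edges : nat := #|edges G|.
Definition num_colors : nat := size (colors (edges G)).

Definition rainbow F : Prop := {in F &, injective (color G)}.

Definition properly_colored F : Prop :=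
  forall E1 E2, E1 \in F -> E2 \in F -> E1 != E2 -> E1 :&: E2 != set0 ->
    color G E1 != color G E2.

Definition C4 (a b c d : V) : {set {set V}} :=
  [set [set a; b]; [set b; c]; [set c; d]; [set d; a]].

Definition has_properly_colored_C4 : Prop :=
  exists a b c d, [/\ uniq [:: a; b; c; d], C4 a b c d \subset edges G
                    & properly_colored (C4 a b c d)].

Definition triangle (u v w : V) : {set {set V}} :=
  [set [set u; v]; [set v; w]; [set u; w]].

(* [S] stands for the subgraph of [G] induced on the vertex set [S], so that
   deleting vertices is set difference. *)
Definition edges_on S : {set {set V}} := [set E in edges G | E \subset S].

Definition complete_on S : Prop :=
  {in S &, forall x y, x != y -> [set x; y] \in edges G}.

Definition complete_exact S : Prop :=
  complete_on S /\ size (colors (edges_on S)) = #|S|.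

(* The requirement that the remaining graph be complete with as many colors as
   vertices is part of [layered_on] of that graph.  [Layered_star] is the base
   of the recursion; [complete_exact S] forces [#|S| >= 3] there. *)
Inductive layered_on : {set V} -> Prop :=
| Layered_vertex S v k of complete_exact S & v \in S &
    (forall E, E \in edges_on S -> v \in E -> color G E = k) &
    layered_on (S :\ v) : layered_on S
| Layered_triangle S u v w red blue green of complete_exact S &
    [set u; v; w] \subset S & uniq [:: u; v; w] & rainbow (triangle u v w) &
    color G [set u; v] = red & color G [set v; w] = blue &
    color G [set u; w] = green &
    (forall E, E \in edges_on S -> E \notin triangle u v w ->
      [/\ u \in E -> color G E = red, v \in E -> color G E = blue
        & w \in E -> color G E = green]) &
    layered_on (S :\: [set u; v; w]) : layered_on S
| Layered_star S v k of complete_exact S & v \in S &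
    rainbow [set E in edges_on S | v \in E] &
    (forall E, E \in edges_on S -> v \notin E -> color G E = k) &
    (forall E, E \in edges_on S -> v \in E -> color G E != k) : layered_on S.

Definition complete : Prop := complete_on [set: V].
Definition layered : Prop := layered_on [set: V].

End EdgeColoredGraphs.

(* Main.v *)
(* A colour is saturated at [v] if it occurs only on edges at [v]; deleting [v] lowers
   e + c by the degree d(v) plus the number s(v) of colours saturated at [v].  If
   d(v) + s(v) <= n for some [v], induct on n.  Otherwise suppose that all d(v) + s(v) > n
   and that there is no properly coloured C4.  If [ac] is an edge and [ax], [cy] have
   colours saturated at [a] and [c] respectively, other than the colour of [ac], then [x]
   and [y] are not adjacent, because of the cycle [axyc].  Applied to a vertex [a] of
   minimum degree and its neighbours [c], this forces so much rigidity that n <= 3.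

   In the case of equality, d(v) + s(v) >= n everywhere, with equality somewhere when
   n > 3, and induction shows that the graph is complete with s >= 1 everywhere.  Choose
   a colour saturated at each [v] and orient the edges of that colour out of [v].  There
   is no directed 4-cycle, and two vertices without an arc between them have the same
   single out-neighbour.  An argument on vertices of maximum out-degree in this almost
   semicomplete digraph yields a dominating vertex, a dominating triangle or a star. *)
Require Import Defs.
From mathcomp Require Import all_boot.
From mathcomp Require Import zify.

Set Implicit Arguments.
Unset Strict Implicit.
Unset Printing Implicit Defensive.

Section EdgeColoredGraph.
Variables (V : finType) (C : eqType) (G : ecgraph V C).
Implicit Types (S : {set V}) (k : C).

(** * Edges and colours of induced subgraphs *)

Definition adj (x y : V) : bool := [set x; y] \in edges G.
Definition col (x y : V) : C := color G [set x; y].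

Lemma adjC x y : adj x y = adj y x.
Proof. by rewrite /adj setUC. Qed.

Lemma colC x y : col x y = col y x.
Proof. by rewrite /col setUC. Qed.

Lemma adj_neq x y : adj x y -> x != y.
Proof. by move/card_edge; rewrite cards2; case: eqP. Qed.

Lemma edges_onP S E :
  reflect (exists x y, [/\ x \in S, y \in S, adj x y & E = [set x; y]])
          (E \in edges_on G S).
Proof.
apply: (iffP idP) => [|[x [y [xS yS xy ->]]]]; last first.
  rewrite inE -[_ \in edges G]/(adj x y) xy; apply/subsetP=> z.
  by rewrite !inE => /orP[]/eqP->.
rewrite inE => /andP[EG ES].
have /eqP/cards2P[x [y [xy EE]]] := card_edge EG.
exists x, y; rewrite /adj -EE; split=> //; apply: (subsetP ES);
  by rewrite EE !inE eqxx ?orbT.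
Qed.

Lemma colorsP S k :
  reflect (exists x y, [/\ x \in S, y \in S, adj x y & k = col x y])
          (k \in colors G (edges_on G S)).
Proof.
rewrite mem_undup; apply: (iffP imageP) => [[E /edges_onP[x [y [xS yS xy ->]]] ->]|].
  by exists x, y.
move=> [x [y [xS yS xy ->]]]; exists [set x; y] => //.
by apply/edges_onP; exists x, y.
Qed.

Lemma num_edges_on_le S : #|edges_on G S| <= 'C(#|S|, 2).
Proof.
rewrite -cards_draws subset_leq_card //; apply/subsetP=> E.
by rewrite !inE => /andP[/card_edge-> ->].
Qed.

Lemma num_colors_on_le S : size (colors G (edges_on G S)) <= #|edges_on G S|.
Proof. by rewrite (leq_trans (size_undup _)) // size_image. Qed.

Lemma num_edges_complete S : complete_on G S -> #|edges_on G S| = 'C(#|S|, 2).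
Proof.
move=> cS; rewrite -cards_draws; apply: eq_card => E; rewrite !inE.
rewrite andbC; case: (boolP (E \subset S)) => //= /subsetP ES.
apply/idP/idP=> [/card_edge/eqP//|/cards2P[x [y [xy EE]]]].
by rewrite EE; apply: cS => //; apply: ES; rewrite EE !inE eqxx ?orbT.
Qed.

(** * Neighbourhoods and saturated colours *)

Definition nbrs S v : {set V} := [set x in S | adj v x].

(* The neighbours [x] of [v] such that the colour of [vx] is saturated at [v] in [S]. *)
Definition sat_nbrs S v : {set V} :=
  [set x in nbrs S v | col v x \notin colors G (edges_on G (S :\ v))].

Definition sat_degree S v : nat := size (undup [seq col v x | x in sat_nbrs S v]).

(* Abstracting the cardinals first keeps [lia] from comparing them up to conversion. *)
Ltac card_lia :=
  repeat match goal with H : is_true (_ <= _)%N |- _ => move: H end;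
  repeat match goal with H : @eq nat _ _ |- _ => move: H end;
  repeat match goal with
    | |- context [@card ?T ?A] => move: (@card T A) => ?
    | |- context [size ?s] => move: (size s) => ?
    | |- context [sat_degree ?S ?v] => move: (sat_degree S v) => ?
    end;
  clear; lia.

Lemma in_nbrs S v x : (x \in nbrs S v) = (x \in S) && adj v x.
Proof. by rewrite inE. Qed.

Lemma sat_nbrsP S v x : x \in sat_nbrs S v ->
  [/\ x \in S, adj v x &
      forall y z, y \in S -> z \in S -> y != v -> z != v -> adj y z ->
        col y z != col v x].
Proof.
rewrite !inE => /andP[/andP[xS vx] nc]; split=> // y z yS zS yv zv yz.
apply: contraNneq nc => <-; apply/colorsP; exists y, z.
by rewrite !inE yv zv.
Qed.

Lemma sat_nbrs_nbrs S v : sat_nbrs S v \subset nbrs S v.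
Proof. by apply/subsetP=> x; rewrite inE => /andP[]. Qed.

Lemma nbrs_sub S v : nbrs S v \subset S :\ v.
Proof.
apply/subsetP=> x; rewrite !inE => /andP[-> /adj_neq].
by rewrite eq_sym => ->.
Qed.

Lemma degree_lt S v : v \in S -> #|nbrs S v| < #|S|.
Proof. by move=> vS; rewrite (cardsD1 v S) vS ltnS subset_leq_card ?nbrs_sub. Qed.

Lemma num_edges_del S v :
  #|edges_on G S| <= #|edges_on G (S :\ v)| + #|nbrs S v|.
Proof.
apply: leq_trans (leq_trans (leq_card_setU _ _) (leq_add (leqnn _)
  (leq_imset_card (fun x => [set v; x]) _))).
apply/subset_leq_card/subsetP => E /edges_onP[x [y [xS yS xy ->]]].
rewrite inE; have [xv|xv] := eqVneq x v.
  by apply/orP; right; apply/imsetP; exists y; rewrite -?xv // inE yS.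
have [yv|yv] := eqVneq y v.
  apply/orP; right; apply/imsetP; exists x; rewrite -?yv 1?setUC //.
  by rewrite inE xS adjC.
by apply/orP; left; apply/edges_onP; exists x, y; rewrite !inE xv yv.
Qed.

Lemma num_colors_del S v :
  size (colors G (edges_on G S)) <=
  size (colors G (edges_on G (S :\ v))) + sat_degree S v.
Proof.
rewrite -size_cat; apply: uniq_leq_size; first exact: undup_uniq.
move=> k kS; rewrite mem_cat.
have [//|kv] := boolP (k \in colors G (edges_on G (S :\ v))).
have /colorsP[x [y [xS yS xy kE]]] := kS.
rewrite mem_undup; apply/imageP; have [xv|xv] := eqVneq x v.
  by subst v; exists y; rewrite // !inE yS xy -kE kv.
have [yv|yv] := eqVneq y v.
  by subst v; exists x; rewrite 1?colC // !inE xS adjC xy colC -kE kv.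
by case/negP: kv; apply/colorsP; exists x, y; rewrite !inE xv yv.
Qed.

(** With [k] excluded, an edge from [v] into this set may follow an edge of colour [k] at [v] in a
    properly coloured cycle. *)
Definition sat_nbrs_but S v k : {set V} := [set x in sat_nbrs S v | col v x != k].

Lemma sat_degree_le S v : sat_degree S v <= #|sat_nbrs S v|.
Proof. by rewrite (leq_trans (size_undup _)) // size_image. Qed.

Lemma sat_degree_but S v k : sat_degree S v <= #|sat_nbrs_but S v k|.+1.
Proof.
rewrite -(size_image (col v) (sat_nbrs_but S v k)).
apply: (@leq_trans (size (k :: [seq col v x | x in sat_nbrs_but S v k]))) => //.
apply: uniq_leq_size (undup_uniq _) _ => l; rewrite mem_undup => /imageP[x xA ->].
rewrite inE; case: eqVneq => //= kx; apply/imageP; exists x => //.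
by rewrite inE xA.
Qed.

(** The colour of [vx] is not saturated at [v], so excluding it removes nothing from
    [sat_nbrs S v]. *)
Lemma sat_degree_but_eq S v x :
  x \in nbrs S v -> x \notin sat_nbrs S v ->
  sat_degree S v <= #|sat_nbrs_but S v (col v x)|.
Proof.
move=> xN xA; rewrite (leq_trans (sat_degree_le S v)) // subset_leq_card //.
apply/subsetP=> y yA; rewrite inE yA /=; apply: contraNneq xA => yx.
by move: xN yA; rewrite !inE yx => -> /andP[_ ->].
Qed.

(** * Properly coloured 4-cycles *)

Definition no_pc_C4 : Prop := forall a b c d, uniq [:: a; b; c; d] ->
  adj a b -> adj b c -> adj c d -> adj d a ->
  col a b != col b c -> col b c != col c d -> col c d != col d a ->
  col d a != col a b -> False.

Lemma set2_disj (a b c d : V) :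
  uniq [:: a; b; c; d] -> [set a; b] :&: [set c; d] = set0.
Proof.
rewrite /= !inE !negb_or => /and4P[/and3P[ab ac ad] /andP[bc bd] cd _].
apply/setP=> x; rewrite !inE.
have [->|_] := eqVneq x a; first by rewrite (negPf ac) (negPf ad) andbF.
by have [->|//] := eqVneq x b; rewrite (negPf bc) (negPf bd).
Qed.

(** Opposite edges of the cycle are disjoint, so only the four consecutive pairs need distinct
    colours. *)
Lemma pc_C4I (a b c d : V) : uniq [:: a; b; c; d] ->
  adj a b -> adj b c -> adj c d -> adj d a ->
  col a b != col b c -> col b c != col c d -> col c d != col d a ->
  col d a != col a b -> has_properly_colored_C4 G.
Proof.
move=> U ab bc cd da n1 n2 n3 n4; exists a, b, c, d; split=> //.
  by apply/subsetP=> E; rewrite !inE -!orbA => /or4P[]/eqP->.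
have D1 := set2_disj U.
have D2 : [set b; c] :&: [set d; a] = set0.
  by apply: set2_disj; rewrite -[_ :: _]/(rot 1 [:: a; b; c; d]) rot_uniq.
move=> E1 E2; rewrite !inE -!orbA.
by case/or4P=> /eqP-> /or4P[]/eqP->; rewrite ?eqxx // ?D1 ?D2 ?(setIC [set c; d])
  ?(setIC [set d; a]) ?D1 ?D2 ?eqxx // => _ _; rewrite // eq_sym.
Qed.

(** Decidable by search over the finite type [V], so no classical axiom enters. *)
Lemma pc_C4_or_none : has_properly_colored_C4 G \/ no_pc_C4.
Proof.
have [/existsP[a /existsP[b /existsP[c /existsP[d]]]]|none] := boolP
    [exists a, exists b, exists c, exists d, [&& uniq [:: a; b; c; d],
     [&& adj a b, adj b c, adj c d & adj d a], col a b != col b c,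
     col b c != col c d & (col c d != col d a) && (col d a != col a b)]].
  case/and5P=> U /and4P[ab bc cd da] n1 n2 /andP[n3 n4]; left.
  exact: (pc_C4I (a := a) (b := b) (c := c) (d := d)).
right=> a b c d U ab bc cd da n1 n2 n3 n4; case/negP: none.
apply/existsP; exists a; apply/existsP; exists b; apply/existsP; exists c.
by apply/existsP; exists d; rewrite ab bc cd da n1 n2 n3 n4 !andbT.
Qed.

(** * The case where d + s exceeds the order at every vertex *)

Hypothesis noC4 : no_pc_C4.

(** In the cycle [a x y c], saturation at [a] separates [ax] from [xy], saturation at [c] separates
    [xy] from [yc], and excluding the colour of [ac] settles the two corners on that edge. *)
Lemma sat_pair_nonadj S a c x y : a \in S -> c \in S -> adj a c ->
  x \in sat_nbrs_but S a (col a c) -> y \in sat_nbrs_but S c (col a c) ->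
  adj x y -> False.
Proof.
move=> aS cS ac; rewrite inE => /andP[/sat_nbrsP[xS ax Hx] nx].
rewrite inE => /andP[/sat_nbrsP[yS cy Hy] ny] xy.
have xa : x != a by rewrite eq_sym adj_neq.
have yc : y != c by rewrite eq_sym adj_neq.
have xc : x != c by apply: contraNneq nx => ->.
have ya : y != a by apply: contraNneq ny => ->; rewrite colC.
apply: (noC4 (a := a) (b := x) (c := y) (d := c)) => //.
- by rewrite /= !inE !negb_or !(eq_sym a) (eq_sym x y) xa ya xc yc andbT /=
    (eq_sym c) (adj_neq ac) eq_sym (adj_neq xy).
- by rewrite adjC.
- by rewrite adjC.
- by rewrite eq_sym; apply: Hx.
- by rewrite (colC y c); apply: Hy.
- by rewrite (colC y c) (colC c a).
- by rewrite (colC c a) eq_sym.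
Qed.

(** Let B be [sat_nbrs_but S v (col v c)]. The hypothesis gives |S| <= d(v) + |B|. By
    [sat_pair_nonadj], some [y] at [c] misses itself and all of B, so d(v) <= d(y) <= |S| - |B + y|.
    Hence [y] is in B and equality holds throughout; were [c] not saturated, s(v) <= |B| would make
    the first inequality strict. *)
Lemma min_degree_nbr S v c :
  (forall u, u \in S -> #|S| < #|nbrs S u| + sat_degree S u) ->
  v \in S -> (forall u, u \in S -> #|nbrs S v| <= #|nbrs S u|) ->
  c \in nbrs S v ->
  [/\ c \in sat_nbrs S v,
      #|nbrs S v| + #|sat_nbrs_but S v (col v c)| = #|S|
    & exists y, [/\ y \in sat_nbrs_but S v (col v c), adj c y
                  & nbrs S y = S :\: sat_nbrs_but S v (col v c)]].
Proof.
move=> Hdeg vS vmin cN; have := cN; rewrite in_nbrs => /andP[cS vc].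
set B := sat_nbrs_but S v (col v c).
have BS : B \subset S by apply/subsetP=> x; rewrite inE => /andP[/sat_nbrsP[]].
(* Since d(c) < |S|, the hypothesis gives s(c) >= 2. *)
have [y yC] : exists y, y \in sat_nbrs_but S c (col v c).
  apply/card_gt0P; have := sat_degree_but S c (col v c).
  have := Hdeg _ cS; have := degree_lt cS; card_lia.
have /sat_nbrsP[yS cy _] : y \in sat_nbrs S c by move: yC; rewrite inE => /andP[].
have Ny : nbrs S y \subset S :\: (y |: B).
  apply/subsetP=> z; rewrite in_nbrs => /andP[zS yz].
  rewrite in_setD zS andbT in_setU1 negb_or eq_sym adj_neq //=.
  by apply/negP=> zB; apply: (sat_pair_nonadj vS cS vc zB yC); rewrite adjC.
have yBS : y |: B \subset S by rewrite subUset sub1set yS.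
have := subset_leq_card Ny; rewrite (cardsDS yBS) cardsU1 => cNy.
have := subset_leq_card yBS; rewrite cardsU1 => cyB.
have vy := vmin _ yS.
have vd := Hdeg _ vS.
have sB : sat_degree S v <= #|B|.+1 := sat_degree_but S v (col v c).
have yB : y \in B by apply/negPn/negP => yB; move: cNy cyB; rewrite yB; card_lia.
rewrite yB add0n in cNy cyB; split; [| card_lia |].
  by apply/negPn/negP => cA; have := sat_degree_but_eq cN cA; rewrite -/B; card_lia.
exists y; split=> //; move: Ny; rewrite (setUidPr _) ?sub1set // => Ny.
by apply/eqP; rewrite eqEcard Ny cardsDS //; card_lia.
Qed.

(** The vertex [y] from [min_degree_nbr] again has minimum degree. If |S| > 3, a second such
    neighbour [y'] of [v] and a common neighbour [z] of [y] and [y'] are found, which yields a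
    forbidden cycle. *)
Lemma high_degree_card S :
  S != set0 -> (forall u, u \in S -> #|S| < #|nbrs S u| + sat_degree S u) ->
  #|S| <= 3.
Proof.
case/set0Pn=> v0 v0S Hdeg; rewrite leqNgt; apply/negP => n4.
case: (arg_minnP (fun u => #|nbrs S u|) v0S) => v vS' vmin.
have {vS'}vS : v \in S := vS'.
have all_sat u x : u \in S -> #|nbrs S u| = #|nbrs S v| -> x \in nbrs S u ->
    x \in sat_nbrs S u.
  move=> uS ud xN; have [|//] := min_degree_nbr Hdeg uS _ xN.
  by move=> w wS; rewrite ud; apply: vmin.
have [c cN] : exists c, c \in nbrs S v.
  apply/card_gt0P; have := sat_degree_le S v; have := Hdeg _ vS.
  have := subset_leq_card (sat_nbrs_nbrs S v); card_lia.
have [cA dv [y [yB cy Ny]]] := min_degree_nbr Hdeg vS vmin cN.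
have BN k x : x \in sat_nbrs_but S v k -> x \in nbrs S v.
  by rewrite inE => /andP[xA _]; apply: (subsetP (sat_nbrs_nbrs S v)).
have BS k : sat_nbrs_but S v k \subset S.
  by apply/subsetP=> x /BN; rewrite in_nbrs => /andP[].
(* All edges at a vertex of minimum degree have colours saturated there, so the 4-cycle
   [v y z y'] is properly coloured. *)
have cycle y' z : y' \in S -> y' != y -> z \in S -> z != v ->
    #|nbrs S y'| = #|nbrs S v| ->
    y' \in nbrs S v -> z \in nbrs S y -> z \in nbrs S y' -> False.
  move=> y'S y'y zS zv dy' y'N zy zy'.
  have yN := BN _ _ yB.
  have yS : y \in S by move: yN; rewrite in_nbrs => /andP[].
  have dy : #|nbrs S y| = #|nbrs S v| by rewrite Ny cardsDS //; card_lia.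
  have vy : adj v y by move: yN; rewrite in_nbrs => /andP[].
  have vy' : adj v y' by move: y'N; rewrite in_nbrs => /andP[].
  have yz : adj y z by move: zy; rewrite in_nbrs => /andP[].
  have y'z : adj y' z by move: zy'; rewrite in_nbrs => /andP[].
  have yv : y != v by rewrite eq_sym adj_neq.
  have y'v : y' != v by rewrite eq_sym adj_neq.
  have zy0 : z != y by rewrite eq_sym adj_neq.
  have [_ _ s1] := sat_nbrsP (all_sat v y vS erefl yN).
  have [_ _ s2] := sat_nbrsP (all_sat v y' vS erefl y'N).
  have [_ _ s3] := sat_nbrsP (all_sat y z yS dy zy).
  have vNy : v \in nbrs S y by rewrite in_nbrs vS adjC.
  have [_ _ s4] := sat_nbrsP (all_sat y v yS dy vNy).
  apply: (noC4 (a := v) (b := y) (c := z) (d := y')) => //.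
  - rewrite /= !inE !negb_or (adj_neq vy) (adj_neq vy') eq_sym zv (adj_neq yz).
    by rewrite (eq_sym y) y'y eq_sym (adj_neq y'z).
  - by rewrite adjC.
  - by rewrite adjC.
  - by rewrite eq_sym; apply: s1.
  - by rewrite eq_sym; apply: s3; rewrite // 1?eq_sym ?adj_neq 1?adjC // eq_sym.
  - by rewrite (colC y'); apply: s2; rewrite // adjC.
  - by rewrite (colC v y); apply: s4; rewrite // 1?adjC // eq_sym.
have NS u : #|nbrs S u| = #|nbrs S v| -> #|sat_nbrs_but S v (col v c)| <= 1 ->
    u \in S -> nbrs S u = S :\ u.
  move=> du cB uS; apply/eqP; rewrite eqEcard nbrs_sub /=.
  by have := cardsD1 u S; rewrite uS; card_lia.
(* Here d(v) >= |S| - 1, so the graph on [S] is complete and any two further vertices serve as [y']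
   and [z]. *)
case: (leqP #|sat_nbrs_but S v (col v c)| 1) => cB.
  have du u : u \in S -> #|nbrs S u| = #|nbrs S v|.
    by move=> uS; have := vmin _ uS; have := degree_lt uS; card_lia.
  have yS : y \in S := subsetP (BS _) _ yB.
  have := BN _ _ yB; rewrite NS // => /setD1P[yv _].
  have /card_gt1P[y' [z [y'R zR y'z]]] : 1 < #|S :\ v :\ y|.
    have := cardsD1 v S; have := cardsD1 y (S :\ v).
    by rewrite vS !inE yv yS; card_lia.
  move: y'R zR; rewrite !inE => /and3P[y'y y'v y'S] /and3P[zy zv zS].
  apply: (cycle y' z y'S y'y zS zv (du _ y'S)); rewrite NS ?du // !inE ?zy ?y'v //.
  by rewrite eq_sym y'z.
(* Applying [min_degree_nbr] to [w] gives [y'] adjacent to [w]; it differs from [y], whose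
   neighbourhood avoids [w]. *)
have [w wB wy] : exists2 w, w \in sat_nbrs_but S v (col v c) & w != y.
  have /card_gt0P[w] : 0 < #|sat_nbrs_but S v (col v c) :\ y|.
    by have := cardsD1 y (sat_nbrs_but S v (col v c)); rewrite yB; card_lia.
  by rewrite in_setD1 => /andP[wy wB]; exists w.
have [_ dw [y' [y'B wy' Ny']]] := min_degree_nbr Hdeg vS vmin (BN _ _ wB).
(* Both excluded sets lie inside the neighbourhood of [v], so a non-neighbour [z] of [v] is adjacent
   to [y] and [y']. *)
have [z zR] : exists z, z \in S :\ v :\: nbrs S v.
  apply/card_gt0P; rewrite cardsDS ?nbrs_sub //.
  by have := cardsD1 v S; rewrite vS; card_lia.
move: zR; rewrite in_setD in_setD1 => /and3P[zN zv zS].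
apply: (cycle y' z) => //; first exact: subsetP (BS _) _ y'B.
- apply: contraTneq (wB) => y'y; have : w \in nbrs S y.
    by rewrite in_nbrs (subsetP (BS _) _ wB) -y'y adjC.
  by rewrite Ny in_setD => /andP[].
- by rewrite Ny' cardsDS //; card_lia.
- exact: BN y'B.
- by rewrite Ny in_setD zS andbT; apply: contra zN; apply: BN.
- by rewrite Ny' in_setD zS andbT; apply: contra zN; apply: BN.
Qed.

(** * The upper bound on e + c *)

Definition weight S : nat := #|edges_on G S| + size (colors G (edges_on G S)).

Lemma weight_del S v : weight S <= weight (S :\ v) + (#|nbrs S v| + sat_degree S v).
Proof.
have := num_edges_del S v; have := num_colors_del S v; rewrite /weight.
by card_lia.
Qed.

(** Both e and c are at most m(m-1)/2, and m(m-1) <= m(m+1)/2 for m <= 3. *)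
Lemma weight_le_small S : #|S| <= 3 -> weight S * 2 <= #|S| * #|S|.+1.
Proof.
have := num_edges_on_le S; have := num_colors_on_le S; rewrite /weight.
by case: #|S| => [|[|[|[|n]]]]; rewrite ?bin2 //=; card_lia.
Qed.

(** The bounds for m and m - 1 vertices differ by m, so a vertex with d + s <= |S| can be deleted;
    [high_degree_card] supplies one when |S| > 3. *)
Lemma weight_le S : weight S * 2 <= #|S| * #|S|.+1.
Proof.
move: {2}#|S| (leqnn #|S|) => n; elim: n => [|n IHn] in S *.
  by move=> S0; apply: weight_le_small; apply: leq_trans S0 _.
move=> Sn; have [|S4] := leqP #|S| 3; first exact: weight_le_small.
have [/existsP[v /andP[vS dv]]|] :=
    boolP [exists v, (v \in S) && (#|nbrs S v| + sat_degree S v <= #|S|)].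
  have cS := cardsD1 v S; rewrite vS in cS.
  have := IHn (S :\ v); have := weight_del S v; move: dv Sn; rewrite cS.
  move: (weight S) (weight (S :\ v)) (_ + sat_degree S v) => a b d.
  by move: #|S :\ v| => m; clear; nia.
rewrite negb_exists => /forallP H; move: (S4); rewrite ltnNge high_degree_card //.
  by rewrite -card_gt0; card_lia.
by move=> u uS; have := H u; rewrite uS /= -ltnNge.
Qed.

(** * The case of equality and completeness *)

Definition tight S : Prop := weight S * 2 = #|S| * #|S|.+1.

(** Otherwise deleting [v] would leave a set violating [weight_le]. *)
Lemma tight_degree S v : tight S -> v \in S -> #|S| <= #|nbrs S v| + sat_degree S v.
Proof.
move=> tS vS; have := weight_le (S :\ v); have := weight_del S v; move: tS.
have := cardsD1 v S; rewrite vS /tight => ->.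
move: (weight S) (weight (S :\ v)) (_ + sat_degree S v) #|S :\ v| => a b d m.
by clear; nia.
Qed.

Lemma tight_del S v : tight S -> v \in S ->
  #|nbrs S v| + sat_degree S v <= #|S| -> tight (S :\ v).
Proof.
move=> tS vS; have := weight_le (S :\ v); have := weight_del S v; move: tS.
have := cardsD1 v S; rewrite vS /tight => ->.
move: (weight S) (weight (S :\ v)) (_ + sat_degree S v) #|S :\ v| => a b d m.
by clear; nia.
Qed.

(** The empty set is tight, but one or two vertices give e + c at most 0 or 2, short of 1 or 3. *)
Lemma tight_small S : tight S -> S != set0 -> 2 < #|S|.
Proof.
rewrite /tight /weight -card_gt0.
have := num_edges_on_le S; have := num_colors_on_le S.
by case: #|S| => [|[|[|n]]]; rewrite ?bin2 //=; card_lia.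
Qed.

Lemma tight_complete S : complete_on G S -> tight S -> complete_exact G S.
Proof.
move=> cS; split=> //; move: H; rewrite /tight /weight num_edges_complete //.
have := mul_bin_diag #|S| 1; rewrite bin1.
case: #|S| => [|m] /=; first by rewrite bin0n /=; card_lia.
by move: (size _) 'C(_, _) => a b; clear; nia.
Qed.

(* The 4-cycle [v x z y] forces [x] and [y] to see every other vertex in the same colour. *)
Lemma sat_nbrs_twins S v x y z : v \in S -> complete_on G (S :\ v) ->
  x \in sat_nbrs S v -> y \in sat_nbrs S v -> col v x != col v y ->
  z \in S -> z != v -> z != x -> z != y -> col x z = col y z.
Proof.
move=> vS cS /sat_nbrsP[xS vx sx] /sat_nbrsP[yS vy sy] nxy zS zv zx zy.
apply/eqP/negPn/negP => xzyz.
have xy : x != y by apply: contraNneq nxy => ->.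
have xv : x != v by rewrite eq_sym adj_neq.
have yv : y != v by rewrite eq_sym adj_neq.
have xz : adj x z by apply: cS; rewrite ?inE ?xv ?zv // eq_sym.
have yz : adj y z by apply: cS; rewrite ?inE ?yv ?zv // eq_sym.
apply: (noC4 (a := v) (b := x) (c := z) (d := y)) => //.
- by rewrite /= !inE !negb_or (adj_neq vx) (adj_neq vy) eq_sym zv (adj_neq xz) xy zy.
- by rewrite adjC.
- by rewrite adjC.
- by rewrite eq_sym; apply: sx.
- by rewrite (colC z).
- by rewrite (colC y v); apply: sy => //; rewrite adjC.
- by rewrite (colC y v) eq_sym.
Qed.

(** Any other [z] saturated at [x] in [S :\ v] has [xz] and [yz] of one colour by [sat_nbrs_twins],
    yet [yz] avoids [x]. So without [y] nothing is saturated at [x], contradicting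
    [tight_degree]. *)
Lemma sat_nbrs_edge S v x y : v \in S -> complete_on G (S :\ v) -> tight (S :\ v) ->
  x \in sat_nbrs S v -> y \in sat_nbrs S v -> col v x != col v y ->
  y \in sat_nbrs (S :\ v) x.
Proof.
move=> vS cS tS xA yA nxy; apply/negPn/negP => yN.
have [xS vx sx] := sat_nbrsP xA; have [yS vy sy] := sat_nbrsP yA.
have xv : x != v by rewrite eq_sym adj_neq.
have yv : y != v by rewrite eq_sym adj_neq.
have xy : x != y by apply: contraNneq nxy => ->.
have xSv : x \in S :\ v by rewrite !inE xv.
have A0 : sat_nbrs (S :\ v) x = set0.
  apply/setP=> z; rewrite [RHS]inE; apply/negP => zA.
  have zy : z != y by apply: contraNneq yN => <-.
  have [/setD1P[zv zS] xz sz] := sat_nbrsP zA.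
  have zx : z != x by rewrite eq_sym adj_neq.
  have /negP[] : col y z != col x z.
    apply: sz; rewrite ?inE ?yv ?zv // 1?eq_sym //.
    by apply: cS; rewrite ?inE ?yv ?zv // eq_sym.
  by apply/eqP/esym; apply: (sat_nbrs_twins vS cS xA yA).
have := tight_degree tS xSv; have := sat_degree_le (S :\ v) x.
by have := degree_lt xSv; rewrite A0 cards0; card_lia.
Qed.

(** A non-neighbour [u] of [v] forces s(v) >= 2, hence [x] and [y] saturated at [v] in distinct
    colours. Any other neighbour [z] of [v] has [vz] and [zx] of one colour, so s(v) = 2 and [u] is
    the only non-neighbour. Then s(u) >= 2 as well, and some [w] makes [u w v x] properly
    coloured. *)
Lemma tight_complete_on S v : tight S -> v \in S -> tight (S :\ v) ->
  complete_on G (S :\ v) -> complete_on G S.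
Proof.
move=> tS vS tSv cSv.
suff vN u : u \in S -> u != v -> adj v u.
  move=> x y xS yS xy; have [xv|xv] := eqVneq x v.
    by subst v; apply: vN => //; rewrite eq_sym.
  have [yv|yv] := eqVneq y v; first by subst v; rewrite -/(adj x y) adjC; apply: vN.
  by apply: cSv; rewrite ?inE ?xv ?yv.
move=> uS uv; apply/negPn/negP => vu.
have uNv : u \notin nbrs S v by rewrite in_nbrs uS.
have dv2 : #|nbrs S v| + 2 <= #|S|.
  have : nbrs S v \subset S :\ v :\ u.
    by rewrite subsetD1 nbrs_sub.
  move/subset_leq_card; have := cardsD1 v S; have := cardsD1 u (S :\ v).
  by rewrite vS !inE uv uS; card_lia.
have degv := tight_degree tS vS.
have [x xA] : exists x, x \in sat_nbrs S v.
  by apply/card_gt0P; have := sat_degree_le S v; card_lia.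
have [y] : exists y, y \in sat_nbrs_but S v (col v x).
  by apply/card_gt0P; have := sat_degree_but S v (col v x); card_lia.
rewrite inE => /andP[yA nyx].
have nxy : col v x != col v y by rewrite eq_sym.
have [xS vx sx] := sat_nbrsP xA; have [yS vy sy] := sat_nbrsP yA.
have xv : x != v by rewrite eq_sym adj_neq.
have yv : y != v by rewrite eq_sym adj_neq.
have xy : x != y by apply: contraNneq nxy => ->.
have [_ _ sxy] := sat_nbrsP (sat_nbrs_edge vS cSv tSv xA yA nxy).
have [_ _ syx] := sat_nbrsP (sat_nbrs_edge vS cSv tSv yA xA nyx).
have axy : adj x y by apply: cSv; rewrite ?inE ?xv ?yv.
(* By the 4-cycles [v z x y] and [v z y x]. *)
have vzx z : z \in nbrs S v -> z != x -> z != y -> col v z = col z x.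
  rewrite in_nbrs => /andP[zS vz] zx zy.
  have zv : z != v by rewrite eq_sym adj_neq.
  have tw := sat_nbrs_twins vS cSv xA yA nxy zS zv zx zy.
  have xz : adj x z by apply: cSv; rewrite ?inE ?xv ?zv // eq_sym.
  have yz : adj y z by apply: cSv; rewrite ?inE ?yv ?zv // eq_sym.
  apply/eqP/negPn/negP => vz_zx.
  have [vzy|vzy] := eqVneq (col v z) (col v y).
    apply: (noC4 (a := v) (b := z) (c := y) (d := x)) => //.
    - by rewrite /= !inE !negb_or (adj_neq vx) (adj_neq vy) eq_sym zv zy zx eq_sym xy.
    - by rewrite adjC.
    - by rewrite adjC.
    - by rewrite adjC.
    - by rewrite (colC z y) -tw (colC x z).
    - rewrite (colC y x); apply: sxy; rewrite ?inE ?yv ?zv // 1?eq_sym //.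
      by rewrite adjC.
    - by rewrite (colC x v); apply: sx => //; rewrite adjC.
    - by rewrite (colC x v) vzy.
  apply: (noC4 (a := v) (b := z) (c := x) (d := y)) => //.
  - by rewrite /= !inE !negb_or (adj_neq vx) (adj_neq vy) eq_sym zv zy zx xy.
  - by rewrite adjC.
  - by rewrite adjC.
  - by rewrite (colC x y); apply: syx; rewrite ?inE ?zv ?xv // adjC.
  - by rewrite (colC y v); apply: sy.
  - by rewrite (colC y v) eq_sym.
(* For a third neighbour [z], the edge [zx] avoids [v] but repeats the colour of [vz]. *)
have Av : sat_nbrs S v \subset [set x; y].
  apply/subsetP=> z zA; rewrite !inE; apply/negPn/negP; rewrite negb_or => /andP[zx zy].
  have [zS vz sz] := sat_nbrsP zA.
  have zv : z != v by rewrite eq_sym adj_neq.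
  have /negP[] : col z x != col v z.
    by apply: sz => //; apply: cSv; rewrite ?inE ?xv ?zv.
  by rewrite vzx // in_nbrs zS.
have Nv : nbrs S v = S :\ v :\ u.
  apply/eqP; rewrite eqEcard subsetD1 nbrs_sub uNv /=.
  have := subset_leq_card Av; rewrite cards2 xy; have := sat_degree_le S v.
  have := cardsD1 v S; have := cardsD1 u (S :\ v).
  by rewrite vS !inE uv uS; card_lia.
have ux : u != x by apply: contraNneq vu => ->.
have uy : u != y by apply: contraNneq vu => ->.
have [w] : exists w, w \in sat_nbrs_but S u (col u x).
  apply/card_gt0P; have := sat_degree_but S u (col u x); have := tight_degree tS uS.
  have : nbrs S u \subset S :\ v :\ u.
    apply/subsetP=> z zN; have := subsetP (nbrs_sub S u) _ zN; rewrite !inE => /andP[-> ->].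
    by rewrite andbT; apply: contraNneq vu => <-; move: zN; rewrite in_nbrs adjC => /andP[].
  move/subset_leq_card; rewrite -Nv; card_lia.
rewrite inE => /andP[/sat_nbrsP[wS uw sw] wx].
have wv : w != v by apply: contraNneq vu => <-; rewrite adjC.
have wu : w != u by rewrite eq_sym adj_neq.
have wx' : w != x by apply: contraNneq wx => ->.
have wy : w != y.
  apply: contraNneq wx => ->; rewrite (colC u x) (colC u y).
  by rewrite (sat_nbrs_twins vS cSv xA yA nxy uS uv ux uy).
have wN : w \in nbrs S v by rewrite Nv !inE wv wS wu.
have vw : adj v w by move: wN; rewrite in_nbrs => /andP[].
apply: (noC4 (a := u) (b := w) (c := v) (d := x)) => //.
- by rewrite /= !inE !negb_or (adj_neq uw) uv ux wv wx' eq_sym xv.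
- by rewrite adjC.
- by apply: cSv; rewrite ?inE ?xv ?uv // eq_sym.
- by rewrite eq_sym; apply: sw => //; rewrite 1?eq_sym // adjC.
- rewrite (colC w v) vzx //; apply: sx => //.
  by apply: cSv; rewrite ?inE ?xv ?wv.
- rewrite eq_sym; apply: sx => //.
  by apply: cSv; rewrite ?inE ?xv ?uv // eq_sym.
- by rewrite (colC x u) eq_sym.
Qed.

(** * The digraph of chosen saturated colours on a complete graph *)

Section Arcs.
Variables (S : {set V}) (k : V -> C).
Hypotheses (cS : complete_on G S) (S4 : 3 < #|S|).
Hypothesis sat_k :
  forall v, v \in S -> exists2 x, x \in sat_nbrs S v & col v x = k v.

Definition out v : {set V} := [set x in sat_nbrs S v | col v x == k v].

Lemma outP a x : x \in out a ->
  [/\ x \in S, x != a, col a x = k a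
    & forall y z, y \in S -> z \in S -> y != z -> y != a -> z != a ->
        col y z != k a].
Proof.
rewrite inE => /andP[/sat_nbrsP[xS ax sx] /eqP xk]; split=> //.
  by rewrite eq_sym adj_neq.
by move=> y z yS zS yz ya za; rewrite -xk sx //; apply: cS.
Qed.

Lemma out_neq0 a : a \in S -> exists x, x \in out a.
Proof. by case/sat_k=> x xA xk; exists x; rewrite inE xA xk /=. Qed.

Lemma mem_out a x : a \in S -> x \in S -> x != a -> col a x = k a -> x \in out a.
Proof.
move=> aS xS xa xk; have [y yA yk] := sat_k aS.
rewrite inE xk eqxx andbT; move: yA; rewrite !inE xS xk -yk => /andP[_ ->].
by rewrite andbT; apply: cS; rewrite // eq_sym.
Qed.

(** The colour of each arc is saturated at its tail, which the next arc avoids. *)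
Lemma out_C4 a b c d : b \in out a -> c \in out b -> d \in out c -> a \in out d ->
  a != c -> b != d -> False.
Proof.
move=> ab bc cd da ac bd.
have [bS ba kab sa] := outP ab; have [cS' cb kbc sb] := outP bc.
have [dS dc kcd sc] := outP cd; have [aS ad kda sd] := outP da.
apply: (noC4 (a := a) (b := b) (c := c) (d := d)).
- rewrite /= !inE !negb_or (eq_sym a b) ba ac ad bd (eq_sym b c) cb.
  by rewrite (eq_sym c d) dc.
- by apply: cS; rewrite // eq_sym.
- by apply: cS; rewrite // eq_sym.
- by apply: cS; rewrite // eq_sym.
- by apply: cS; rewrite // eq_sym.
- by rewrite kab eq_sym; apply: sa; rewrite // eq_sym.
- by rewrite kbc eq_sym; apply: sb; rewrite // eq_sym.
- by rewrite kcd eq_sym; apply: sc; rewrite // eq_sym.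
- by rewrite kda eq_sym; apply: sd; rewrite // eq_sym.
Qed.

(** With no arc between them, the colour of [ac] is neither [k a] nor [k c]; distinct [x] and [y]
    would be adjacent, against [sat_pair_nonadj]. As [x] and [y] are arbitrary, both
    out-neighbourhoods are the same singleton. *)
Lemma out_nonarc a c x y : a \in S -> c \in S -> a != c ->
  c \notin out a -> a \notin out c -> x \in out a -> y \in out c -> x = y.
Proof.
move=> aS cS' ac ca' ac' xa yc; apply/eqP/negPn/negP => xy.
have [xS _ kx _] := outP xa; have [yS _ ky _] := outP yc.
have xA : x \in sat_nbrs S a by move: xa; rewrite inE => /andP[].
have yA : y \in sat_nbrs S c by move: yc; rewrite inE => /andP[].
apply: (@sat_pair_nonadj S a c x y) => //; [exact: cS| | |exact: cS].
  rewrite inE xA kx; apply: contraNneq ca' => kE; apply: mem_out => //.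
  by rewrite eq_sym.
rewrite inE yA ky colC; apply: contraNneq ac' => kE; exact: mem_out.
Qed.

(** The edge [ac] makes [k a] equal to [k c]; a second edge [ax] of that colour would avoid [c],
    where the colour is saturated. *)
Lemma out_biarc a c x : c \in out a -> a \in out c -> x \in out a -> x = c.
Proof.
move=> ca ac xa; apply/eqP/negPn/negP => xc.
have [cS' cna kac _] := outP ca; have [aS _ kca sc] := outP ac.
have [xS xna kax _] := outP xa.
have /negP[] : col a x != k c by apply: sc; rewrite // eq_sym.
by rewrite -kca (colC c a) kac kax.
Qed.

(* A vertex [r] of maximum out-degree dominates everything, or lies on a directed
   triangle; any further vertex dominating that triangle would close a directed 4-cycle
   with an out-neighbour of [r]. *)
Lemma dominating_vertex_or_triangle (R : {set V}) :
  R \subset S -> R != set0 ->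
  {in R & S :\: R, forall r t, t \in out r} ->
  {in R &, forall r t, r != t -> (t \in out r) || (r \in out t)} ->
  (exists2 v, v \in S & forall x, x \in S -> x != v -> x \in out v) \/
  (exists u v w, [/\ v \in out u, w \in out v, u \in out w &
     forall t, t \in S -> t \notin [set u; v; w] ->
       [/\ t \in out u, t \in out v & t \in out w]]).
Proof.
move=> RS /set0Pn[r0 r0R] Hdom Htot.
case: (arg_maxnP (fun u => #|out u|) r0R) => r rR' rmax.
have {rR'}rR : r \in R := rR'.
have RSin t : t \in R -> t \in S by apply: (subsetP RS).
have dom t u : t \in S -> u \in R -> t != u -> t \notin out u -> u \in out t.
  move=> tS uR tu tou; have tR : t \in R.
    by apply: contraNT tou => tR; apply: Hdom; rewrite // inE tR.
  by have := Htot _ _ uR tR; rewrite (negPf tou) eq_sym; apply.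
have inR t u : t \in S -> u \in R -> t \notin out u -> t \in R.
  by move=> tS uR; apply: contraNT => tR; apply: Hdom; rewrite // inE tR.
have [/forallP Hr|] := boolP [forall x, (x \in S) && (x != r) ==> (x \in out r)].
  left; exists r; first exact: RSin.
  by move=> x xS xr; have := Hr x; rewrite xS xr.
rewrite negb_forall => /existsP[w]; rewrite negb_imply => /andP[/andP[wS wr] wor].
have wR := inR _ _ wS rR wor; have row := dom _ _ wS rR wr wor.
(* If [out r] were inside [out t], maximality would make them equal, and [r] would be its own
   out-neighbour. *)
have exists_out t : t \in R -> r \in out t -> exists2 y, y \in out r & y \notin out t.
  move=> tR rt; apply/subsetPn/negP => rt_sub.
  have E : out r = out t by apply/eqP; rewrite eqEcard rt_sub; apply: rmax.
  by move: rt; rewrite -E => /outP[_]; rewrite eqxx.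
have [y yr yw] := exists_out w wR row.
have [yS ynr _ _] := outP yr.
have yw' : y != w by apply: contraNneq wor => <-.
have yR := inR _ _ yS wR yw; have wy := dom _ _ yS wR yw' yw.
(* Such a [t] has an arc into the triangle [r y w]; excluding directed 4-cycles passes it on from
   [r] to [w], from [w] to [y] and from [y] to [r]. *)
have in3 t : t \in S -> t != r -> t != y -> t != w ->
    [|| t \notin out r, t \notin out y | t \notin out w] ->
    [/\ r \in out t, y \in out t & w \in out t].
  move=> tS tr ty tw.
  have Hr : r \in out t -> w \in out t.
    move=> rt; apply: dom => //; apply/negP => wt.
    by apply: (out_C4 wt rt yr wy) => //; rewrite eq_sym.
  have Hw : w \in out t -> y \in out t.
    move=> wt; apply: dom => //; apply/negP => yt.
    by apply: (out_C4 yt wt row yr) => //; rewrite eq_sym.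
  have Hy : y \in out t -> r \in out t.
    move=> yt; apply: dom => //; apply/negP => rt.
    by apply: (out_C4 rt yt wy row) => //; rewrite eq_sym.
  case/or3P=> H; [have rt := dom t r tS rR tr H| have yt := dom t y tS yR ty H
    | have wt := dom t w tS wR tw H]; split; auto.
right; exists r, y, w; split=> // t tS tN.
have /and3P[tr ty tw] : [&& t != r, t != y & t != w].
  by move: tN; rewrite !inE !negb_or -andbA.
have [/(in3 t tS tr ty tw)[rt yt wt]|] :=
    boolP [|| t \notin out r, t \notin out y | t \notin out w];
  last by rewrite !negb_or !negbK => /and3P.
have tor : t \notin out r.
  by apply/negP=> tr'; case/eqP: ty; rewrite (out_biarc tr' rt yr).
have tR := inR _ _ tS rR tor.
(* This [z] will close the directed cycle [t r y z]. *)
have [z zr zt] := exists_out t tR rt.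
have [zS znr _ _] := outP zr.
have zt' : z != t by apply: contraNneq tor => <-.
have tz := dom _ _ zS tR zt' zt.
have zny : z != y by apply: contraNneq zt => ->.
have znw : z != w by apply: contraNneq zt => ->.
have zy : z \in out y.
  apply/negPn/negP => zy; have [] := in3 z zS znr zny znw; first by rewrite zy orbT.
  by move=> rz _ _; case/eqP: zny; rewrite (out_biarc zr rz yr).
by case: (out_C4 rt yr zy tz) => //; rewrite eq_sym.
Qed.

(** If some [a] and [c] have no arc between them, let [x] be their common out-neighbour, [P] the
    vertices whose only out-neighbour is [x], and [R] the rest apart from [x]. Then [R] dominates
    [P] and [x] and has an arc between any two of its vertices, so [dominating_vertex_or_triangle]
    applies unless [R] is empty; in that case [x] is the centre of a star. *)
Lemma star_or_dominating :
  (exists x c, [/\ x \in S, {in S :\ x &, forall p q, p != q -> col p q = c}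
     & {in S :\ x &, forall p q, col p x != c /\ (p != q -> col p x != col q x)}]) \/
  (exists2 v, v \in S & forall x, x \in S -> x != v -> x \in out v) \/
  (exists u v w, [/\ v \in out u, w \in out v, u \in out w &
     forall t, t \in S -> t \notin [set u; v; w] ->
       [/\ t \in out u, t \in out v & t \in out w]]).
Proof.
have S0 : S != set0 by rewrite -card_gt0 (leq_trans _ S4).
have [/existsP[a /existsP[c /and5P[aS cS' ac ca' ac']]]|] := boolP [exists a, exists c,
    [&& a \in S, c \in S, a != c, c \notin out a & a \notin out c]]; last first.
  move=> noarc; right; apply: dominating_vertex_or_triangle S0 _ _ => //.
    by move=> r t _; rewrite setDv inE.
  move=> r t rS tS rt; apply: contraNT noarc; rewrite negb_or => /andP[trN rtN].
  by apply/existsP; exists r; apply/existsP; exists t; rewrite rS tS rt trN.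
have [x xa] := out_neq0 aS; have [xS xna _ _] := outP xa.
have [x' xc] := out_neq0 cS'.
have ? := out_nonarc aS cS' ac ca' ac' xa xc; subst x'.
have [_ xnc _ _] := outP xc.
pose P := [set p in S :\ x | [exists y, y \in out p] && (out p \subset [set x])].
have PP p : p \in P -> [/\ p \in S, p != x & out p = [set x]].
  rewrite in_set in_setD1 => /andP[/andP[px pS] /andP[/existsP[y yp] sub]]; split=> //.
  apply/eqP; rewrite eqEsubset sub sub1set; move: (subsetP sub _ yp).
  by rewrite inE => /eqP <-.
(* A vertex other than [x] without an arc to or from a member of [P] is itself in [P], by
   [out_nonarc]. *)
have inP p q y : p \in S -> p != x -> q \in S -> p != q -> q \notin out p ->
    p \notin out q -> y \in out q -> out q \subset [set x] -> p \in P.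
  move=> pS px qS pq qp pq' yq /subsetP sub; rewrite in_set in_setD1 px pS /=.
  have yx : y = x by apply/set1P/sub.
  subst y; apply/andP; split.
    by have [z zp] := out_neq0 pS; apply/existsP; exists z.
  by apply/subsetP=> z zp; rewrite inE (out_nonarc pS qS pq qp pq' zp yq).
have aP : a \in P.
  rewrite in_set in_setD1 eq_sym xna aS /=; apply/andP; split.
    by apply/existsP; exists x.
  by apply/subsetP=> z za; rewrite inE (out_nonarc aS cS' ac ca' ac' za xc).
have cP : c \in P.
  have [_ _ oa] := PP _ aP.
  by apply: (@inP c a x); rewrite // ?oa ?set11 ?subxx // eq_sym.
pose R := S :\ x :\: P.
have RP r : r \in R -> [/\ r \in S, r != x & r \notin P].
  by rewrite in_setD in_setD1 => /and3P[-> -> ->].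
have domP r p : r \in R -> p \in P -> p \in out r.
  case/RP=> rS rx rP pP; have [pS px op] := PP _ pP.
  apply: contraNT (rP) => prN.
  apply: (@inP r p x); rewrite // ?op ?set11 ?subxx // ?inE //.
  by apply: contraNneq rP => ->.
(* If [r] is in [out x], then [a x r c] is properly coloured although [ca] is no arc. With no arc
   between [r] and [x], [out r] would be a singleton, but it contains [a] and [c]. *)
have domx r : r \in R -> x \in out r.
  move=> rR; have [rS rx rP] := RP _ rR.
  have [ar cr] := (domP _ _ rR aP, domP _ _ rR cP).
  apply/negPn/negP => xr; have [rx'|rx'] := boolP (r \in out x).
    have [_ _ ka sa] := outP xa; have [_ _ kx sx] := outP rx'.
    have [_ ar' _ _] := outP ar; have [_ cr' kr sr] := outP cr.
    apply: (noC4 (a := a) (b := x) (c := r) (d := c)).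
    - rewrite /= !inE !negb_or (eq_sym a x) xna ar' ac (eq_sym x r) rx xnc.
      by rewrite (eq_sym r c) cr'.
    - by apply: cS; rewrite // eq_sym.
    - by apply: cS; rewrite // eq_sym.
    - by apply: cS; rewrite // eq_sym.
    - by apply: cS; rewrite // eq_sym.
    - by rewrite ka eq_sym; apply: sa; rewrite // eq_sym.
    - by rewrite kx eq_sym; apply: sx; rewrite // eq_sym.
    - by rewrite kr eq_sym; apply: sr; rewrite // eq_sym.
    - rewrite ka (colC c a); apply: contraNneq ca' => kE.
      by apply: mem_out; rewrite // eq_sym.
  have [y yx] := out_neq0 xS.
  have ay := out_nonarc rS xS rx xr rx' ar yx.
  by case/eqP: ac; rewrite ay (out_nonarc rS xS rx xr rx' cr yx).
have [R0|/set0Pn[r0 r0R]] := eqVneq R set0; last first.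
  right; apply: (@dominating_vertex_or_triangle R).
  - by apply/subsetP=> r /RP[].
  - by apply/set0Pn; exists r0.
  - move=> r t rR; rewrite in_setD => /andP[tR tS].
    have [->|tx] := eqVneq t x; first exact: domx.
    apply: domP => //; apply: contraNT tR => tP.
    by rewrite in_setD in_setD1 tP tx tS.
  - move=> r t rR tR rt; have [[rS _ _] [tS _ _]] := (RP _ rR, RP _ tR).
    apply/negPn/negP; rewrite negb_or => /andP[trN rtN].
    have at' := domP _ _ tR aP.
    have ca := out_nonarc rS tS rt trN rtN (domP _ _ rR cP) at'.
    by case/eqP: ac.
have SP p : p \in S :\ x -> p \in P.
  move=> pS; apply/negPn/negP => pP; have : p \in R by apply/setDP.
  by rewrite R0 in_set0.
left; exists x, (col a c).
have xP p : p \in P -> [/\ p \in S, p != x, col p x = k p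
    & forall y z, y \in S -> z \in S -> y != z -> y != p -> z != p -> col y z != k p].
  by move=> pP; have [pS px op] := PP _ pP; case: (@outP p x) => //; rewrite op inE.
have nk p y : p \in P -> y \in S -> y != x -> y != p -> col p y != k p.
  move=> pP yS yx yp; have [pS _ op] := PP _ pP.
  by apply: contraNneq yx => kE; have := mem_out pS yS yp kE; rewrite op inE.
(* Otherwise [p q r x] is properly coloured: [rx] and [xp] have colours [k r] and [k p], which no
   other edge at [r] or [p] has. *)
have adj3 p q r : p \in P -> q \in P -> r \in P -> p != q -> q != r -> p != r ->
    col p q = col q r.
  move=> pP qP rP pq qr pr; apply/eqP/negPn/negP => ne.
  have [pS px kp sp] := xP _ pP; have [qS qx kq sq] := xP _ qP.
  have [rS rx kr sr] := xP _ rP.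
  apply: (noC4 (a := p) (b := q) (c := r) (d := x)) => //.
  - by rewrite /= !inE !negb_or pq pr px qr qx rx.
  - exact: cS.
  - exact: cS.
  - exact: cS.
  - by apply: cS; rewrite // eq_sym.
  - by rewrite kr (colC q r) nk.
  - by rewrite (colC x p) kp; apply: sp; rewrite // eq_sym.
  - by rewrite (colC x p) kp eq_sym nk // eq_sym.
have aq q : q \in P -> q != a -> col a q = col a c.
  move=> qP qa; have [->//|qc] := eqVneq q c.
  by rewrite colC (@adj3 q a c).
split=> // [p q /SP pP /SP qP pq|p q /SP pP /SP qP].
  have [pa|pa] := eqVneq p a; first by rewrite pa aq // -pa eq_sym.
  have [->|qa] := eqVneq q a; first by rewrite colC aq.
  by rewrite (@adj3 p q a) // colC aq.
have [pS px kp sp] := xP _ pP; have [qS qx kq sq] := xP _ qP; split.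
  rewrite kp eq_sym; have [->|pa] := eqVneq p a.
    by rewrite nk // eq_sym.
  have [->|pc] := eqVneq p c; first by rewrite colC nk // eq_sym.
  by apply: sp; rewrite // eq_sym.
by move=> pq; rewrite kp eq_sym; apply: sp; rewrite // 1?eq_sym // eq_sym.
Qed.

End Arcs.

(** * Layered structure of tight sets *)

Lemma edges_on_incident S x E : E \in edges_on G S -> x \in E ->
  exists2 y, y \in nbrs S x & E = [set x; y].
Proof.
case/edges_onP=> a [b [aS bS ab ->]] /set2P[->|->].
  by exists b; rewrite // in_nbrs bS.
by exists a; rewrite 1?setUC // in_nbrs aS adjC.
Qed.

Lemma layered_star_pairs S x c : complete_exact G S -> x \in S ->
  {in S :\ x &, forall p q, p != q -> col p q = c} ->
  {in S :\ x &, forall p q, col p x != c /\ (p != q -> col p x != col q x)} ->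
  layered_on G S.
Proof.
move=> eS xS Hc Hx; have nS := subsetP (nbrs_sub S x).
apply: (@Layered_star _ _ G S x c) => //.
- move=> E1 E2; rewrite !inE => /andP[E1S xE1] /andP[E2S xE2].
  have [p pN ->] : exists2 y, y \in nbrs S x & E1 = [set x; y].
    by apply: edges_on_incident; rewrite // inE.
  have [q qN ->] : exists2 y, y \in nbrs S x & E2 = [set x; y].
    by apply: edges_on_incident; rewrite // inE.
  have [_ ne] := Hx _ _ (nS _ pN) (nS _ qN).
  rewrite -/(col x p) -/(col x q) (colC x p) (colC x q) => e.
  by have [->//|/ne] := eqVneq p q; rewrite e eqxx.
- move=> E /edges_onP[p [q [pS qS pq ->]]].
  rewrite !inE negb_or => /andP[xp xq].
  by apply: Hc; rewrite ?adj_neq // !inE eq_sym ?pS ?qS andbT.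
- move=> E ES xE; have [p pN ->] := edges_on_incident ES xE.
  by have [] := Hx _ _ (nS _ pN) (nS _ pN); rewrite (colC p x).
Qed.

(** Here e = c = 3, so [S] spans a rainbow triangle, which is a star at any of its vertices:
    [S :\ v] is the one edge avoiding [v]. *)
Lemma tight_layered_small S : tight S -> S != set0 -> #|S| <= 3 ->
  complete_exact G S /\ layered_on G S.
Proof.
move=> tS S0 S3; have {S3} S3 : #|S| = 3.
  by have := tight_small tS S0; card_lia.
have eS : #|edges_on G S| = 3 /\ size (colors G (edges_on G S)) = 3.
  have := num_edges_on_le S; have := num_colors_on_le S.
  by move: tS; rewrite /tight /weight S3 bin2 /=; split; card_lia.
have edgesE : edges_on G S = [set E : {set V} | (E \subset S) && (#|E| == 2)].
  apply/eqP; rewrite eqEcard cards_draws S3 bin2 /= eS.1 andbT.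
  by apply/subsetP=> E; rewrite !inE => /andP[/card_edge-> ->].
have cS : complete_on G S.
  move=> x y xS yS xy; have : [set x; y] \in edges_on G S.
    by rewrite edgesE inE cards2 xy subUset !sub1set xS yS.
  by rewrite inE => /andP[].
have rS : {in edges_on G S &, injective (color G)}.
  apply/dinjectiveP; apply/negPn; rewrite -ltn_size_undup -leqNgt.
  by rewrite [X in _ <= X]eS.2 size_image eS.1.
have xS3 : complete_exact G S by split; rewrite // S3 eS.2.
split=> //; have [v vS] := set0Pn _ S0.
have ES : S :\ v \in edges_on G S.
  by rewrite edgesE inE subD1set /=; have := cardsD1 v S; rewrite vS S3 add1n => -[<-].
apply: (@Layered_star _ _ G S v (color G (S :\ v))) => //.
- by move=> E1 E2; rewrite !inE => /andP[H1 _] /andP[H2 _]; apply: rS; rewrite inE.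
- move=> E; rewrite edgesE inE => /andP[Es /eqP E2] vE; congr color.
  apply/eqP; rewrite eqEcard subsetD1 Es vE E2 /=.
  by move: ES; rewrite edgesE inE => /andP[_ /eqP->].
- move=> E EE vE; apply: contraTneq vE => /(rS _ _ EE ES)->.
  by rewrite !inE eqxx.
Qed.

Lemma tight_layered_step S : tight S -> 3 < #|S| ->
  (forall T, tight T -> T != set0 -> #|T| < #|S| ->
     complete_exact G T /\ layered_on G T) ->
  complete_exact G S /\ layered_on G S.
Proof.
move=> tS S4 IH.
have S0 : S != set0 by rewrite -card_gt0 (leq_trans _ S4).
have del0 v : v \in S -> S :\ v != set0 /\ #|S :\ v| < #|S|.
  by move=> vS; have := cardsD1 v S; rewrite vS -card_gt0; split; card_lia.
(* By [high_degree_card] some [v] has d + s <= |S|; deleting it leaves a tight set, complete by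
   induction. *)
have cS : complete_on G S.
  have [/existsP[v /andP[vS dv]]|] :=
      boolP [exists v, (v \in S) && (#|nbrs S v| + sat_degree S v <= #|S|)].
    have tSv := tight_del tS vS dv; have [Sv0 Sv] := del0 _ vS.
    by have [[cSv _] _] := IH _ tSv Sv0 Sv; apply: tight_complete_on cSv.
  rewrite negb_exists => /forallP H; move: (S4); rewrite ltnNge high_degree_card //.
  by move=> u uS; have := H u; rewrite uS /= -ltnNge.
have eS := tight_complete cS tS; split=> //.
pose k v := col v (odflt v [pick x in sat_nbrs S v]).
(* Since d(v) < |S|, [tight_degree] gives s(v) >= 1, so [pick] succeeds. *)
have sat_k v : v \in S -> exists2 x, x \in sat_nbrs S v & col v x = k v.
  move=> vS; rewrite /k; case: pickP => [x xA|A0]; first by exists x.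
  have := tight_degree tS vS; have := degree_lt vS; have := sat_degree_le S v.
  by rewrite (eq_card0 A0); card_lia.
case: (star_or_dominating cS S4 sat_k) => [[x [c [xS Hc Hx]]]|[[v vS Hv]|]].
- exact: layered_star_pairs eS xS Hc Hx.
- have kv E : E \in edges_on G S -> v \in E -> color G E = k v.
    move=> ES vE; have [x] := edges_on_incident ES vE.
    rewrite in_nbrs => /andP[xS /adj_neq vx] ->.
    by have /(outP cS)[] : x \in out S k v by apply: Hv; rewrite // eq_sym.
  apply: (Layered_vertex eS vS kv).
  have [Sv0 Sv] := del0 _ vS; suff tSv : tight (S :\ v) by case: (IH _ tSv Sv0 Sv).
  (* All edges at [v] have colour [k v], so s(v) <= 1 while d(v) <= |S| - 1. *)
  apply: tight_del => //.
  have := sat_degree_but S v (k v).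
  have -> : sat_nbrs_but S v (k v) = set0.
    apply/setP=> x; rewrite [RHS]inE; apply/negP; rewrite inE => /andP[xA].
    have [xS vx _] := sat_nbrsP xA.
    have /(outP cS)[_ _ -> _] : x \in out S k v by apply: Hv; rewrite // eq_sym adj_neq.
    by rewrite eqxx.
  by have := degree_lt vS; rewrite cards0; card_lia.
move=> [u [v [w [uv vw wu dom]]]].
have [vS vu kuv su] := outP cS uv.
have [wS wv kvw sv] := outP cS vw.
have [uS uw kwu sw] := outP cS wu.
have uniq3 : uniq [:: u; v; w].
  by rewrite /= !inE !negb_or (eq_sym u v) vu uw (eq_sym v w) wv.
have k_uv : k v != k u by rewrite -kvw; apply: su; rewrite // eq_sym.
have k_vw : k w != k v by rewrite -kwu; apply: sv; rewrite // eq_sym.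
have k_wu : k u != k w by rewrite -kuv; apply: sw; rewrite // eq_sym.
set T3 := [set u; v; w].
have T3S : T3 \subset S by rewrite !subUset !sub1set uS vS wS.
have cT3 : #|T3| = 3.
  by rewrite /T3 setUC cardsU1 !inE cards2 negb_or (eq_sym w) uw (eq_sym w) (eq_sym v w) wv eq_sym vu.
set T := S :\: T3.
have cT : #|S| = #|T| + 3 by have := subset_leq_card T3S; rewrite cardsDS // cT3; card_lia.
have TS : {subset T <= S} by move=> x /setDP[].
(* Removing the triangle loses at most the colours [k u], [k v] and [k w], so at least |T| colours
   remain on the complete graph on [T]; [weight_le] gives the converse bound. *)
have tT : tight T.
  have cmplT : complete_on G T by move=> x y /TS xS /TS yS; apply: cS.
  have cST : size (colors G (edges_on G S)) <= size (colors G (edges_on G T)) + 3.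
    rewrite (_ : 3 = size [:: k u; k v; k w]) // -size_cat.
    apply: uniq_leq_size; first exact: undup_uniq.
    move=> l /colorsP[p [q [pS qS pq ->]]]; rewrite mem_cat.
    have col3 x y : x \in T3 -> y \in S -> x != y -> col x y \in [:: k u; k v; k w].
      move=> xT yS xy; have [yT|yT] := boolP (y \in T3); last first.
        have [/(outP cS)[_ _ e1 _] /(outP cS)[_ _ e2 _] /(outP cS)[_ _ e3 _]] := dom _ yS yT.
        move: xT; rewrite !inE -orbA => /or3P[]/eqP->;
          by rewrite ?e1 ?e2 ?e3 eqxx ?orbT.
      move: xT yT xy; rewrite !inE -!orbA => /or3P[]/eqP-> /or3P[]/eqP->;
        rewrite ?eqxx // => _; rewrite ?(colC v u) ?(colC u w) ?(colC w v);
        by rewrite ?kuv ?kvw ?kwu eqxx ?orbT.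
    have [pT|pT] := boolP (p \in T3); first by rewrite col3 ?orbT ?adj_neq.
    have [qT|qT] := boolP (q \in T3).
      by rewrite colC col3 ?orbT // eq_sym adj_neq.
    apply/orP; left; apply/colorsP; exists p, q; split=> //; exact/setDP.
  have := weight_le T; rewrite /tight /weight num_edges_complete //.
  move: cST; rewrite eS.2 cT; have := mul_bin_diag #|T| 1; rewrite bin1.
  move: (size _) 'C(_, _) => a b; case: #|T| => [|m] /=; clear; nia.
have T0 : T != set0 by rewrite -card_gt0; move: cT S4; card_lia.
have TltS : #|T| < #|S| by rewrite cT; card_lia.
have [eT lT] := IH _ tT T0 TltS.
apply: (@Layered_triangle _ _ G S u v w (k u) (k v) (k w)) => //.
- have e1 : color G [set u; v] = k u by [].
  have e2 : color G [set v; w] = k v by [].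
  have e3 : color G [set u; w] = k w by rewrite setUC.
  move=> E1 E2; rewrite !inE -!orbA => /or3P[]/eqP-> /or3P[]/eqP-> //;
    rewrite ?e1 ?e2 ?e3 => e; by move: k_uv k_vw k_wu; rewrite e eqxx.
- by rewrite setUC.
- move=> E ES ET.
  have key x y : [set x; y] \notin triangle u v w -> x \in T3 -> x != y -> y \notin T3.
    move=> nT xT xy; apply: contraNN nT => yT.
    move: xT yT xy; rewrite !inE -!orbA => /or3P[]/eqP-> /or3P[]/eqP->;
      rewrite ?eqxx // => _; rewrite ?eqxx ?orbT // setUC ?eqxx ?orbT //.
  have key2 x : x \in T3 -> x \in E -> exists y, [/\ E = [set x; y], y \in S & y \notin T3].
    move=> xT xE; have [y] := edges_on_incident ES xE.
    rewrite in_nbrs => /andP[yS /adj_neq xy] EE; exists y; split=> //.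
    by apply: key xT xy; rewrite -EE.
  split=> xE; (have [|y [-> yS yT]] := key2 _ _ xE; first by rewrite !inE eqxx ?orbT);
    by have [/(outP cS)[_ _ e1 _] /(outP cS)[_ _ e2 _] /(outP cS)[_ _ e3 _]] := dom _ yS yT.
Qed.

Lemma tight_layered S : tight S -> S != set0 -> complete_exact G S /\ layered_on G S.
Proof.
move: {2}#|S| (leqnn #|S|) => n; elim: n => [|n IHn] in S *.
  by rewrite leqn0 cards_eq0 => ->.
move=> Sn tS S0; have [S3|S4] := leqP #|S| 3; first exact: tight_layered_small.
by apply: tight_layered_step => // T tT T0 cT; apply: IHn => //; card_lia.
Qed.

End EdgeColoredGraph.

Theorem theorem6 (V : finType) (C : eqType) (G : ecgraph V C) (n : nat)
    (n_gt0 : 0 < n) (order_G : #|V| = n) :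
  (num_edges G + num_colors G >= (n * (n + 1)) %/ 2 + 1 ->
     has_properly_colored_C4 G) /\
  (num_edges G + num_colors G = (n * (n + 1)) %/ 2 ->
     ~ has_properly_colored_C4 G -> complete G /\ layered G).
Proof.
have edgesT : edges_on G [set: V] = edges G.
  by apply/setP=> E; rewrite inE subsetT andbT.
have weightT : weight G [set: V] = num_edges G + num_colors G.
  by rewrite /weight edgesT.
(* One of two consecutive integers is even, so the division is exact. *)
have even_n : n * (n + 1) = ((n * (n + 1)) %/ 2) * 2.
  by rewrite divnK // dvdn2 oddM oddD addbT andbN.
split=> [H|H nC4].
  have [//|noC4] := pc_C4_or_none G.
  have := weight_le noC4 [set: V]; rewrite weightT cardsT order_G; lia.
have [//|noC4] := pc_C4_or_none G.
have [| |[cT _] lT] := tight_layered noC4 (S := [set: V]).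
- by rewrite /tight weightT cardsT order_G H -even_n addn1.
- by rewrite -card_gt0 cardsT order_G.
by [].
Qed.
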